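(* Let $\alpha\in\mathbb{S}_m$. Then $\Phi\big(w_{\mathfrak{gl}}(\alpha^{-1})\big)=(-1)^m\,\Phi\big(w_{\mathfrak{gl}}(\alpha)\big)\big|_{S_i\mapsto(-1)^iS_i,\ i=1,2,\dots}$, where $\Phi$ is the Schur substitution.
   Context: For $N\ge1$ and $\alpha\in\mathbb{S}_m$, $w_{\mathfrak{gl}(N)}(\alpha)=\sum_{i_1,\dots,i_m=1}^N E_{i_1i_{\alpha(1)}}\cdots E_{i_mi_{\alpha(m)}}\in ZU(\mathfrak{gl}(N))$, $E_{ij}$ the matrix units; $C_k^{(N)}=w_{\mathfrak{gl}(N)}((1,\dots,k))$. The universal $\mathfrak{gl}$-weight system $w_{\mathfrak{gl}}:\bigsqcup_m\mathbb{S}_m\to\mathbb{C}[N,C_1,C_2,\dots]$ is the unique function such that for every $N\ge1$ the specialization $C_k\mapsto C_k^{(N)}$ sends $w_{\mathfrak{gl}}(\alpha)$ to $w_{\mathfrak{gl}(N)}(\alpha)$. The Schur substitution is the $\mathbb{C}[N]$-algebra isomorphism $\Phi:\mathbb{C}[N][C_1,C_2,\dots]\to\mathbb{C}[N][S_1,S_2,\dots]$ determined by the identity of formal power series in $u$: $1-Nu-\sum_{k\ge1}\Phi(C_k)u^{k+1}=\left(\frac{1-(N+1)u/2}{1-(N-1)u/2}\right)^N\frac{1+\sum_{i\ge1}S_i\big(\frac{u}{1-(N-1)u/2}\big)^i}{1+\sum_{i\ge1}S_i\big(\frac{u}{1-(N+1)u/2}\big)^i}$; e.g. $\Phi(C_1)=S_1$,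 $\Phi(C_2)=2S_2-S_1^2-\tfrac1{12}(N-1)N(N+1)$. (Under the Harish-Chandra isomorphism, $S_k$ corresponds to the complete homogeneous symmetric function of degree $k$ in $x_i=E_{ii}+\frac{N+1}{2}-i$.) *)

(* Defs.v *)
From mathcomp Require Import all_boot all_fingroup all_algebra.
From mathcomp Require Import complex.
From mathcomp Require Import Rstruct.
From mathcomp Require Import mpoly.
Set Implicit Arguments.
Unset Strict Implicit.
Unset Printing Implicit Defensive.
Import GRing.Theory.
Local Open Scope ring_scope.

Notation CC := (complex.complex Rdefinitions.R).

(* U(gl(N)) over C, presented as the free associative algebra on the   *)
(* matrix units E_ij (i,j < N) modulo the two-sided ideal generated by  *)
(*   E_ij E_kl - E_kl E_ij - (delta_jk E_il - delta_li E_kj).           *)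
Section UglN.
Variable N : nat.

(* the generator E_ij is the pair (i, j) *)
Definition gen := ('I_N * 'I_N)%type.
Definition word := seq gen.
(* an element of the free algebra as a finite formal linear combination
   of words (noncommutative monomials) *)
Definition felt := seq (CC * word)%type.

Definition fcoef (x : felt) (w : word) : CC := \sum_(p <- x | p.2 == w) p.1.

Definition fone : felt := [:: (1, [::])].
Definition fadd (x y : felt) : felt := x ++ y.
Definition fscale (c : CC) (x : felt) : felt := [seq (c * a.1, a.2) | a <- x].
Definition fmul (x y : felt) : felt :=
  [seq (a.1 * b.1, a.2 ++ b.2) | a <- x, b <- y].
Definition fpow (x : felt) (k : nat) : felt := iter k (fmul x) fone.

(* u * (E_a E_b - E_b E_a - [E_a, E_b]) * v, with a = (i,j), b = (k,l),
   [E_ij, E_kl] = delta_jk E_il - delta_li E_kj *)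
Definition relator (r : word * gen * gen * word) : felt :=
  let: (u, a, b, v) := r in
  let: (i, j) := a in let: (k, l) := b in
  [:: (1, u ++ [:: a; b] ++ v); (-1, u ++ [:: b; a] ++ v);
      (- ((j == k)%:R), u ++ [:: (i, l)] ++ v);
      ((l == i)%:R, u ++ [:: (k, j)] ++ v)].

Definition in_ideal (z : felt) : Prop :=
  exists rs : seq (CC * (word * gen * gen * word)),
    forall w, fcoef z w = fcoef (flatten [seq fscale r.1 (relator r.2) | r <- rs]) w.

Definition ucong (x y : felt) : Prop := in_ideal (fadd x (fscale (-1) y)).

Definition wglN (m : nat) (f : 'I_m -> 'I_m) : felt :=
  [seq (1, [seq (i t, i (f t)) | t <- enum 'I_m]) | i : {ffun 'I_m -> 'I_N} <- enum {ffun 'I_m -> 'I_N}].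

Definition CasN (k : nat) : felt := wglN (@ordS k).

(* specialization of P in C[N, C_1, ..., C_n] (variable 0 is N, variable
   j >= 1 is C_j) at N |-> N, C_j |-> C_j^{(N)} *)
Definition evalU (n : nat) (P : {mpoly CC[n.+1]}) : felt :=
  flatten [seq fscale (P@_mm * (N%:R) ^+ (mm ord0))
             (foldr (fun (j : 'I_n.+1) acc => fmul (fpow (CasN (val j)) (mm j)) acc) fone
                    [seq j <- enum 'I_n.+1 | j != ord0])
          | mm <- msupp P].
End UglN.

Definition is_universal_wgl (m : nat) (f : 'I_m -> 'I_m) (n : nat)
    (P : {mpoly CC[n.+1]}) : Prop :=
  forall N : nat, (0 < N)%N -> ucong (evalU N P) (wglN N f).

(* The Schur substitution, on C[N, C_1, ..., C_n] with values in        *)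
(* C[N, S_1, ..., S_{n+1}] (variable 0 is N, variable i >= 1 is S_i).   *)
(* Formal power series in u are coefficient sequences nat -> T.         *)
Section Schur.
Variable n : nat.
Local Notation T := {mpoly CC[n.+2]}.

Definition ser := nat -> T.
Definition sone : ser := fun k => (k == 0%N)%:R.
Definition sU : ser := fun k => (k == 1%N)%:R.
Definition sconst (c : T) : ser := fun k => if k == 0%N then c else 0.
Definition sadd (f g : ser) : ser := fun k => f k + g k.
Definition ssub (f g : ser) : ser := fun k => f k - g k.
Definition smul (f g : ser) : ser := fun k => \sum_(i < k.+1) f i * g (k - i)%N.
Definition spow (f : ser) (j : nat) : ser := iter j (smul f) sone.
Definition sgeom (c : T) : ser := fun k => c ^+ k.

Definition Nv : T := 'X_ord0.
(* S_i for 1 <= i <= n+1 (S_i := 0 beyond; only coefficients of u^k,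
   k <= n+1, are used below, and those involve only S_1, ..., S_{n+1}) *)
Definition Sv (i : nat) : T := if (0 < i <= n.+1)%N then 'X_(inord i) else 0.
Definition half : T := ((2%:R : CC)^-1)%:MP.
Definition cplus : T := half * (Nv + 1).
Definition cminus : T := half * (Nv - 1).

Definition sfrac (c : T) : ser := fun k =>
  sone k + \sum_(1 <= i < k.+1) Sv i * spow (smul sU (sgeom c)) i k.

Definition binN (j : nat) : T :=
  ((j`!%:R : CC)^-1)%:MP * \prod_(i < j) (Nv - i%:R).

(* (1 + g)^N := sum_j binom(N, j) g^j, for g with zero constant term *)
Definition spowN (g : ser) : ser := fun k => \sum_(j < k.+1) binN j * spow g j k.

Definition ratioN : ser :=
  spowN (ssub (smul (ssub sone (smul (sconst cplus) sU)) (sgeom cminus)) sone).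

Definition slhs (phi : nat -> T) : ser := fun k =>
  if k == 0%N then 1 else if k == 1%N then - Nv else - phi k.-1.

(* phi_k = Phi(C_k) for k = 1..n : the defining identity
     (1 - N u - sum_k Phi(C_k) u^{k+1}) * (1 + sum_i S_i (u/(1-(N+1)u/2))^i)
       = ((1-(N+1)u/2)/(1-(N-1)u/2))^N * (1 + sum_i S_i (u/(1-(N-1)u/2))^i)
   (the denominator has constant term 1), compared up to order u^{n+1},
   which determines phi_1, ..., phi_n. *)
Definition schur_values (phi : nat -> T) : Prop :=
  forall k, (k <= n.+1)%N ->
    smul (slhs phi) (sfrac cplus) k = smul ratioN (sfrac cminus) k.

Definition Phi (phi : nat -> T) (P : {mpoly CC[n.+1]}) : T :=
  comp_mpoly [tuple (if i == ord0 then 'X_ord0 else phi (val i)) | i < n.+1] P.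

Definition sign_subst (p : T) : T :=
  comp_mpoly [tuple ((-1) ^+ (val i) *: 'X_i) | i < n.+2] p.
End Schur.

(* Main.v *)
(* The map E_ij |-> - E_{N+1-j, N+1-i} is an automorphism of gl(N) that preserves the Borel
   subalgebra and sends w(alpha) to (-1)^m w(alpha^-1).  Let v be a highest weight vector of
   weight lam.  The Casimirs act on v by scalars c_k(lam), and for the twisted action v is
   again a highest weight vector, of weight lam'_i = - lam_{N+1-i}; hence
     Q(N, c(lam)) = (-1)^m P(N, c(lam')).
   The generating series of the c_k is prod_i (1 - (mu_i + 1) u) / (1 - mu_i u) with
   mu_i = lam_i + N - i (Perelomov-Popov), which says that Phi expresses C_k through the
   complete symmetric functions of x_i = lam_i + (N+1)/2 - i; and lam |-> lam' turns x into
   - x up to order, that is S_i into (-1)^i S_i.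
   This proves the identity at the points given by highest weights.  Products of leading
   minors of a generic N x N matrix realize all partitions lam; these are Zariski dense, and
   for N > n every value of (S_1, ..., S_{n+1}) is attained by some x in C^N because the
   inverse of 1 + sum_i S_i T^i, truncated at order n + 2, splits into linear factors. *)

From HB Require Import structures.
Require Import Defs.
From mathcomp Require Import all_boot all_fingroup all_algebra.
From mathcomp Require Import complex.
From mathcomp Require Import Rstruct.
From mathcomp Require Import mpoly.
From mathcomp Require Import ring zify.
Import GRing.Theory Num.Theory.
Local Open Scope ring_scope.

Set Implicit Arguments.
Unset Strict Implicit.
Unset Printing Implicit Defensive.

(** * Highest weight vectors and the action of the Casimirs *)

Section Action.
Variables (N : nat) (M : lmodType CC).
Implicit Types (D : 'I_N -> 'I_N -> {linear M -> M}) (v : M) (x y : felt N).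

Definition gl_relations D := forall i j k l v,
  D i j (D k l v) - D k l (D i j v) =
  (j == k)%:R *: D i l v - (l == i)%:R *: D k j v.

Definition highest_weight D (lam : 'I_N -> CC) v :=
  (forall i j : 'I_N, (i < j)%N -> D i j v = 0) /\
  (forall i, D i i v = lam i *: v).

Definition act D (w : word N) v : M := foldr (fun g : gen N => D g.1 g.2) v w.
Definition actf D x v : M := \sum_(p <- x) p.1 *: act D p.2 v.

Lemma act_linear D w : linear (act D w).
Proof. by elim: w => [|g w IH] c u v //=; rewrite IH linearP. Qed.

HB.instance Definition _ D w :=
  GRing.isLinear.Build CC M M *:%R (act D w) (act_linear D w).

Lemma act_cat D w1 w2 v : act D (w1 ++ w2) v = act D w1 (act D w2 v).
Proof. by rewrite /act foldr_cat. Qed.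

Lemma actf_linear D x : linear (actf D x).
Proof.
move=> c u v; rewrite /actf scaler_sumr -big_split /=; apply: eq_bigr => p _.
by rewrite linearP scalerDr !scalerA mulrC.
Qed.

HB.instance Definition _ D x :=
  GRing.isLinear.Build CC M M *:%R (actf D x) (actf_linear D x).

Lemma actf_cat D x y v : actf D (x ++ y) v = actf D x v + actf D y v.
Proof. by rewrite /actf big_cat. Qed.

Lemma actf_flatten D (s : seq (felt N)) v :
  actf D (flatten s) v = \sum_(x <- s) actf D x v.
Proof. by rewrite /actf big_flatten. Qed.

Lemma actf_scale D c x v : actf D (fscale c x) v = c *: actf D x v.
Proof.
by rewrite /actf /fscale big_map scaler_sumr; apply: eq_bigr => p _; rewrite scalerA.
Qed.

Lemma actf_one D v : actf D (fone N) v = v.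
Proof. by rewrite /actf big_seq1 scale1r. Qed.

Lemma actf_mul D x y v : actf D (fmul x y) v = actf D x (actf D y v).
Proof.
rewrite /actf /fmul big_allpairs_dep /=; apply: eq_bigr => p _.
rewrite linear_sum scaler_sumr; apply: eq_bigr => q _.
by rewrite act_cat linearZ scalerA.
Qed.

(** A word may occur several times in the list [x]; collecting its occurrences shows that the action
    depends on the coefficients [fcoef] alone. *)
Lemma actf_coef D x (ws : seq (word N)) v :
  uniq ws -> {subset [seq p.2 | p <- x] <= ws} ->
  actf D x v = \sum_(w <- ws) fcoef x w *: act D w v.
Proof.
move=> uws; elim: x => [|p x IH] sub; rewrite /actf.
  by rewrite big_nil big1 // => w _; rewrite /fcoef big_nil scale0r.
rewrite big_cons -/(actf D x v) IH; last first.
  by move=> w wx; apply: sub; rewrite inE wx orbT.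
have pws : p.2 \in ws by apply: sub; rewrite inE eqxx.
rewrite [RHS](eq_bigr (fun w => (if w == p.2 then p.1 *: act D w v else 0)
    + fcoef x w *: act D w v)); last first.
  move=> w _; rewrite /fcoef big_cons eq_sym.
  by case: eqP => _; rewrite ?scalerDl ?add0r.
rewrite big_split -big_mkcond /=; congr (_ + _).
by rewrite -big_filter filter_pred1_uniq // big_seq1.
Qed.

Lemma actf_ext D x y v : (forall w, fcoef x w = fcoef y w) -> actf D x v = actf D y v.
Proof.
move=> e; set ws := undup ([seq p.2 | p <- x] ++ [seq p.2 | p <- y]).
rewrite !(@actf_coef D _ ws) ?undup_uniq //.
- by apply: eq_bigr => w _; rewrite e.
- by move=> w wy; rewrite mem_undup mem_cat wy orbT.
- by move=> w wx; rewrite mem_undup mem_cat wx.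
Qed.

Lemma actf_relator D r v : gl_relations D -> actf D (relator r) v = 0.
Proof.
case: r => [[[u [i j]] [k l]] w] glD.
rewrite /actf /relator !big_cons big_nil /= !act_cat /=.
have := congr1 (act D u) (glD i j k l (act D w v)); rewrite !linearB !linearZ /=.
by rewrite scale1r scaleN1r addr0 addrA scaleNr => ->; rewrite addrACA scalerN subrr addNr addr0.
Qed.

(** Relators act by zero, so the action of the free algebra descends to U(gl(N)). *)
Lemma ucong_actf D x y v : gl_relations D -> ucong x y -> actf D x v = actf D y v.
Proof.
move=> glD [rs e]; apply/eqP; rewrite -subr_eq0 -scaleN1r -actf_scale -actf_cat.
rewrite (actf_ext _ _ e) actf_flatten big_map big1 // => r _.
by rewrite actf_scale actf_relator // scaler0.
Qed.

Lemma actf_pow D x c k v : actf D x v = c *: v -> actf D (fpow x k) v = c ^+ k *: v.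
Proof.
move=> e; elim: k => [|k IH]; first by rewrite actf_one expr0 scale1r.
by rewrite actf_mul IH linearZ /= e scalerA exprSr.
Qed.

Lemma actf_evalU D n (P : {mpoly CC[n.+1]}) (c : nat -> CC) v :
  (forall j : 'I_n.+1, j != ord0 -> actf D (CasN N j) v = c j *: v) ->
  actf D (evalU N P) v =
  P.@[fun j : 'I_n.+1 => if j == ord0 then N%:R else c j] *: v.
Proof.
move=> hc; rewrite /evalU actf_flatten big_map mevalE scaler_suml.
apply: eq_bigr => mm _; rewrite actf_scale.
rewrite (bigD1 ord0) //= mulrA -[RHS]scalerA; congr (_ *: _).
rewrite -big_filter [in RHS]/index_enum -enumT.
have : all (fun j => j != ord0) [seq j <- enum 'I_n.+1 | j != ord0] by apply: filter_all.
elim: [seq j <- _ | _] => [|j s IH] /=; first by rewrite big_nil scale1r actf_one.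
case/andP=> j0 /IH {}IH; rewrite big_cons (negPf j0) actf_mul IH linearZ /=.
by rewrite (actf_pow _ (hc _ j0)) scalerA mulrC.
Qed.

(* The (i, j) entry of the k-th power of the matrix (E_ij). *)
Fixpoint Epow D k i j v : M :=
  if k is k'.+1 then \sum_l D i l (Epow D k' l j v) else (i == j)%:R *: v.

(** The entries of a matrix power transform under the adjoint action like the generators themselves.
    Induction on [k] by the Leibniz rule for commutators. *)
Lemma Epow_comm D k a b c d v : gl_relations D ->
  D a b (Epow D k c d v) - Epow D k c d (D a b v) =
  (b == c)%:R *: Epow D k a d v - (a == d)%:R *: Epow D k c b v.
Proof.
move=> glD; elim: k a b c d v => [|k IH] a b c d v /=.
  by rewrite linearZ subrr !scalerA [b == c]eq_sym mulrC subrr.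
rewrite linear_sum -sumrB.
have step l : D a b (D c l (Epow D k l d v)) - D c l (Epow D k l d (D a b v)) =
    ((b == c)%:R *: D a l (Epow D k l d v) - (l == a)%:R *: D c b (Epow D k l d v)) +
    ((b == l)%:R *: D c l (Epow D k a d v) - (a == d)%:R *: D c l (Epow D k l b v)).
  by rewrite -glD -!linearZ -linearB -IH linearB addrA subrK.
rewrite (eq_bigr _ (fun l _ => step l)).
rewrite /= big_split /= !sumrB -!scaler_sumr addrA; congr (_ - _).
(* The two inner sums collapse to l = a and l = b; both leave [D c b (Epow D k a d v)], with
   opposite signs. *)
rewrite [X in _ - X](bigD1 a) //= eqxx scale1r [X in _ - (_ + X)]big1 ?addr0; last first.
  by move=> l /negPf ->; rewrite scale0r.
rewrite [X in _ + X](bigD1 b) //= eqxx scale1r [X in _ - _ + (_ + X)]big1 ?addr0 ?subrK //.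
by move=> l; rewrite eq_sym => /negPf ->; rewrite scale0r.
Qed.

(* Eigenvalue of the i-th diagonal entry of the matrix power (E_ij)^k on a highest weight
   vector, where mu_i = lam_i + N - 1 - i (i counted from 0). *)
Fixpoint diag_eigen (mu : 'I_N -> CC) k (i : 'I_N) : CC :=
  if k is k'.+1
  then mu i * diag_eigen mu k' i - \sum_(l < N | (i < l)%N) diag_eigen mu k' l
  else 1.

Definition shifted (lam : 'I_N -> CC) (i : 'I_N) : CC := lam i + (N - i.+1)%:R.

(** Induction on [k] in [sum_l E_il (E^k)_lj]. The terms l < j vanish by induction, and l = j gives
    the factor [lam i] if i = j and nothing if i < j, where [E_ij] is a raising operator. The terms
    l > j are reduced to a commutator. *)
Lemma Epow_highest D lam v k : gl_relations D -> highest_weight D lam v ->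
  forall i j : 'I_N, (i <= j)%N ->
  Epow D k i j v = (i == j)%:R *: (diag_eigen (shifted lam) k i *: v).
Proof.
move=> glD [up diag]; elim: k => [|k IH] i j ij /=; first by rewrite scale1r.
(* Since i <= j < l, [E_il] kills v, and only its commutator with [(E^k)_lj] remains. *)
have below : \sum_(l < N | ~~ (l <= j)%N) D i l (Epow D k l j v) =
    \sum_(l < N | (j < l)%N) ((i == j)%:R *: (diag_eigen (shifted lam) k i *: v)
       - (i == j)%:R *: (diag_eigen (shifted lam) k l *: v)).
  apply: eq_big => [l|l]; rewrite -ltnNge // => jl.
  have := Epow_comm k i l l j v glD.
  rewrite up ?(leq_ltn_trans ij) //.
  rewrite [X in _ - X = _ -> _](_ : _ = 0); last first.
    by elim: (k) (l) => [|k' IH'] l' /=; rewrite ?scaler0 // big1 // => ? _; rewrite IH' linear0.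
  by rewrite subr0 eqxx scale1r => ->; rewrite !IH // eqxx scale1r.
rewrite (bigID (fun l : 'I_N => (l <= j)%N)) /= below (bigD1 j) //= big1 ?addr0; last first.
  move=> l /andP [lj nlj]; rewrite IH // (negPf nlj) scale0r linear0 //.
rewrite IH // eqxx scale1r linearZ /=.
have [<-|nij] := eqVneq i j; last first.
  rewrite up ?scaler0 ?add0r ?scale0r; last by rewrite ltn_neqAle nij.
  by rewrite big1 // => l _; rewrite !scale0r subrr.
rewrite diag !scale1r; under eq_bigr => l _ do rewrite -?scalerBl !scale1r.
rewrite sumrB -[X in _ - X]scaler_suml scalerBl addrA; congr (_ - _).
(* Each l > i contributes one more copy of the i-th eigenvalue; these N - 1 - i copies turn [lam i]
   into the shifted weight. *)
rewrite sumr_const -scaler_nat !scalerA -scalerDl; congr (_ *: _).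
rewrite /shifted mulrDl [lam i * _]mulrC; congr (_ + _%:R * _).
rewrite -sum1_card (eq_bigl (fun l : 'I_N => true && (i.+1 <= l)%N)) //.
by rewrite -(big_geq_mkord _ _ xpredT (fun=> 1%N)) sum_nat_const_nat muln1.
Qed.

Lemma actf_wglN D m (f : 'I_m -> 'I_m) v :
  actf D (wglN N f) v =
  \sum_(i : {ffun 'I_m -> 'I_N}) act D [seq (i t, i (f t)) | t <- enum 'I_m] v.
Proof.
by rewrite /actf /wglN big_map big_enum /=; apply: eq_bigr => i _; rewrite scale1r.
Qed.

Lemma sum_tupleS k (F : k.+1.-tuple 'I_N -> M) :
  \sum_t F t = \sum_x \sum_(t : k.-tuple 'I_N) F [tuple of x :: t].
Proof.
rewrite pair_big /= (reindex (fun p : 'I_N * k.-tuple 'I_N => [tuple of p.1 :: p.2])) //.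
exists (fun t : k.+1.-tuple 'I_N => (thead t, [tuple of behead t])) => [[x t]|t] _ /=.
  by congr (_, _); apply: val_inj.
by rewrite [RHS]tuple_eta; apply: val_inj.
Qed.

(** A matrix power is a sum over paths from i to j, with intermediate vertices [s]; this is the
    bridge to the words of [wglN]. *)
Lemma Epow_path D k i j v :
  Epow D k.+1 i j v =
  \sum_(s : k.-tuple 'I_N) act D (zip (i :: s) (rcons s j)) v.
Proof.
elim: k i => [|k IH] i.
  rewrite /= (bigD1 j) //= eqxx scale1r big1 ?addr0; last first.
    by move=> l /negPf ->; rewrite scale0r linear0.
  rewrite (bigD1 [tuple]) //= big1 ?addr0 // => s.
  by case/eqP; apply: val_inj; case: s => [[]].
rewrite -[LHS]/(\sum_l D i l (Epow D k.+1 l j v)) sum_tupleS; apply: eq_bigr => l _.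
by rewrite IH linear_sum.
Qed.

(** The words of [wglN] for the cyclic shift are the closed paths, so a Casimir acts as the trace of
    a matrix power. *)
Lemma actf_CasN D k v : actf D (CasN N k.+1) v = \sum_i Epow D k.+1 i i v.
Proof.
rewrite actf_wglN (eq_bigr _ (fun i _ => Epow_path D k i i v)).
rewrite (reindex (fun t : k.+1.-tuple 'I_N => [ffun i => tnth t i])) /=; last first.
  exists (fun f : {ffun 'I_k.+1 -> 'I_N} => [tuple f i | i < k.+1]) => [t|f] _.
    by apply: eq_from_tnth => i; rewrite tnth_mktuple ffunE.
  by apply/ffunP => i; rewrite ffunE tnth_mktuple.
rewrite sum_tupleS; apply: eq_bigr => x _; apply: eq_bigr => s _.
congr (act D _ v); apply: (@eq_from_nth _ (x, x)).
  by rewrite size_map size_enum_ord size_zip size_rcons /= size_tuple minnn.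
move=> a; rewrite size_map size_enum_ord => ak.
rewrite (nth_map ord0) ?size_enum_ord // nth_zip ?size_rcons //= !ffunE.
rewrite !(tnth_nth x) /= nth_enum_ord //; congr (_, _).
(* [ordS] wraps around at the last position only, back to the starting index [x], which is what
   [rcons] appends there. *)
rewrite nth_rcons size_tuple; have [ak'|ka] := ltnP a k; first by rewrite modn_small.
have -> : a = k by apply/eqP; rewrite eqn_leq ka andbT.
by rewrite modnn eqxx.
Qed.

Lemma actf_CasN_highest D lam v k : gl_relations D -> highest_weight D lam v ->
  actf D (CasN N k.+1) v = (\sum_i diag_eigen (shifted lam) k.+1 i) *: v.
Proof.
move=> glD hw; rewrite actf_CasN scaler_suml; apply: eq_bigr => i _.
by rewrite (Epow_highest _ glD hw) // eqxx scale1r.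
Qed.

(** * The twisted action and the duality at one highest weight *)

Definition twist D i j : {linear M -> M} := (-%R \o D (rev_ord j) (rev_ord i)).

Lemma twist_relations D : gl_relations D -> gl_relations (twist D).
Proof.
move=> glD i j k l v; have DN a b u : D a b (- u) = - D a b u by rewrite linearN.
rewrite /= !DN !opprK glD !(inj_eq rev_ord_inj).
by rewrite !scalerN opprK addrC [i == l]eq_sym [k == j]eq_sym.
Qed.

Lemma twist_highest D lam v : highest_weight D lam v ->
  highest_weight (twist D) (fun i => - lam (rev_ord i)) v.
Proof.
case=> up diag; split=> [i j ij|i] /=; last by rewrite diag scaleNr.
by rewrite up ?oppr0 //= ltn_sub2l ?ltnS // (leq_ltn_trans ij) // -ltnS ltnW.
Qed.

Lemma act_twist D w v :
  act (twist D) w v =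
  (-1) ^+ size w *: act D [seq (rev_ord g.2, rev_ord g.1) | g <- w] v.
Proof.
elim: w => [|g w IH] /=; first by rewrite scale1r.
by rewrite IH linearZ /= exprS -scalerA scaleN1r.
Qed.

(** The t-th letter of the twisted word has indices [rev i_alpha(t)] and [rev i_t]. In terms of
    [j_t = rev i_alpha(t)] they are [j_t] and [j_(alpha^-1(t))], so the letters of the word for the
    inverse appear already in the right order. *)
Lemma actf_twist D m (alpha : 'S_m) v :
  actf (twist D) (wglN N alpha) v = (-1) ^+ m *: actf D (wglN N (alpha^-1)%g) v.
Proof.
rewrite !actf_wglN scaler_sumr.
rewrite (reindex (fun j : {ffun 'I_m -> 'I_N} =>
    [ffun t => rev_ord (j ((alpha^-1)%g t))])) /=; last first.
  exists (fun i : {ffun 'I_m -> 'I_N} => [ffun t => rev_ord (i (alpha t))]) => f _;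
    by apply/ffunP => t; rewrite !ffunE rev_ordK ?permK ?permKV.
apply: eq_bigr => j _; rewrite act_twist size_map size_enum_ord -map_comp.
congr (_ *: act D _ v); apply: eq_map => t /=.
by rewrite !ffunE !rev_ordK permK.
Qed.

(** The same vector is used twice: [P] computes the twisted action of [wglN N alpha] on it, [Q] the
    original action of the inverse, and [actf_twist] compares the two scalars. *)
Lemma universal_duality D lam v n m (alpha : 'S_m) (P Q : {mpoly CC[n.+1]}) :
  let c lam k := \sum_i diag_eigen (shifted lam) k i in
  let pt c := fun j : 'I_n.+1 => if j == ord0 then N%:R else c (val j) in
  (0 < N)%N -> gl_relations D -> highest_weight D lam v -> v != 0 ->
  is_universal_wgl alpha P -> is_universal_wgl (alpha^-1)%g Q ->
  Q.@[pt (c lam)] = (-1) ^+ m * P.@[pt (c (fun i => - lam (rev_ord i)))].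
Proof.
move=> c pt N0 glD hw v0 hP hQ.
have cas D' lam' : gl_relations D' -> highest_weight D' lam' v ->
    forall j : 'I_n.+1, j != ord0 -> actf D' (CasN N j) v = c lam' j *: v.
  by move=> gl' hw' [[|j] jn] // _; apply: actf_CasN_highest.
have eP := ucong_actf v (twist_relations glD) (hP _ N0).
have eQ := ucong_actf v glD (hQ _ N0).
rewrite (actf_evalU _ (cas _ _ (twist_relations glD) (twist_highest hw))) in eP.
rewrite actf_twist -eQ (actf_evalU _ (cas _ _ glD hw)) scalerA in eP.
have : (Q.@[pt (c lam)] - (-1) ^+ m * P.@[pt (c (fun i => - lam (rev_ord i)))]) *: v == 0.
  rewrite scalerBl -scalerA eP !scalerA mulrA -exprD addnn -mul2n exprM sqrrN !expr1n mul1r.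
  by rewrite subrr.
by rewrite scaler_eq0 (negPf v0) orbF subr_eq0 => /eqP.
Qed.

End Action.

(** * Power series as polynomials modulo [X^K] *)

Section Truncation.
Variable F : fieldType.
Implicit Types (a p q r t T H R Pm Pp Am Ap : {poly F}) (K : nat).

Definition cong K p q := forall k, (k < K)%N -> p`_k = q`_k.

Lemma cong_refl K p : cong K p p. Proof. by []. Qed.

Lemma cong_sym K p q : cong K p q -> cong K q p.
Proof. by move=> e k kK; rewrite e. Qed.

Lemma cong_trans K q p r : cong K p q -> cong K q r -> cong K p r.
Proof. by move=> e1 e2 k kK; rewrite e1 ?e2. Qed.

Lemma congD K p q p' q' : cong K p q -> cong K p' q' -> cong K (p + p') (q + q').
Proof. by move=> e e' k kK; rewrite !coefD e ?e'. Qed.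

Lemma congB K p q p' q' : cong K p q -> cong K p' q' -> cong K (p - p') (q - q').
Proof. by move=> e e' k kK; rewrite !coefB e ?e'. Qed.

Lemma congM K p q p' q' : cong K p q -> cong K p' q' -> cong K (p * p') (q * q').
Proof.
move=> e e' k kK; rewrite !coefM; apply: eq_bigr => i _.
by rewrite e ?e' // (leq_ltn_trans _ kK) ?leq_subr // -ltnS.
Qed.

Lemma congX K p q j : cong K p q -> cong K (p ^+ j) (q ^+ j).
Proof. by move=> e; elim: j => [|j IH] //; rewrite !exprS; apply: congM. Qed.

Lemma cong_prod K (I : Type) (s : seq I) (p q : I -> {poly F}) :
  (forall i, cong K (p i) (q i)) -> cong K (\prod_(i <- s) p i) (\prod_(i <- s) q i).
Proof.
move=> e; elim: s => [|i s IH]; first by rewrite !big_nil.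
by rewrite !big_cons; apply: congM.
Qed.

Lemma cong_cancel K a p q : a`_0 != 0 -> cong K (a * p) (a * q) -> cong K p q.
Proof.
move=> a0 e k; elim/ltn_ind: k => k IH kK.
have := e _ kK; rewrite !coefM !big_ord_recl /= subn0.
rewrite [X in _ + X = _ -> _](eq_bigr (fun i : 'I_k =>
  a`_(bump 0 i) * q`_(k - bump 0 i))) => [|i _].
  by move/addIr/(mulfI a0).
rewrite IH //; last by rewrite (leq_ltn_trans _ kK) ?leq_subr.
by rewrite /bump add1n; have := ltn_ord i; lia.
Qed.

Lemma coef_exp_small t j k : t`_0 = 0 -> (k < j)%N -> (t ^+ j)`_k = 0.
Proof.
move=> t0; elim: j k => [|j IH] k // kj; rewrite exprS coefM big1 // => [[[|i] ik]] _ /=.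
  by rewrite t0 mul0r.
by rewrite IH ?mulr0 //; lia.
Qed.

Lemma cong_comp K p q t : t`_0 = 0 -> cong K p q -> cong K (p \Po t) (q \Po t).
Proof.
move=> t0 e k kK; apply/eqP; rewrite -subr_eq0 -coefB -rmorphB /= comp_polyE coef_sum.
apply/eqP; apply: big1 => i _; rewrite coefZ.
have [iK|Ki] := ltnP i K; first by rewrite coefB e // subrr mul0r.
by rewrite coef_exp_small ?mulr0 // (leq_trans kK).
Qed.

Lemma sum_ord_trim (a b : nat) (f : nat -> F) : (a <= b)%N ->
  (forall j, (a <= j)%N -> f j = 0) -> \sum_(j < b) f j = \sum_(j < a) f j.
Proof.
move=> ab f0; rewrite -!(big_mkord predT) (big_cat_nat _ (n := a)) //=.
by rewrite [X in _ + X]big_nat_cond [X in _ + X]big1 ?addr0 // => j /andP [/andP [/f0]].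
Qed.

Lemma geom_inverse K (c : F) : cong K ((1 - c *: 'X) * \poly_(k < K) c ^+ k) 1.
Proof.
move=> k kK; rewrite mulrBl mul1r -scalerAl coefB coefZ coefXM !coef_poly kK coef1.
case: k kK => [|k] kK; first by rewrite mulr0 subr0.
by rewrite /= ltnW // exprS subrr.
Qed.

(** As quotients of series, T = Pp/Pm, H = Ap/Pp, R = Ap/Am and H' = Am/Pm, so both products equal
    Ap/Pm. *)
Lemma cong_cross K T H R H' Pm Pp Am Ap :
  Pm`_0 != 0 -> Pp`_0 != 0 -> Am`_0 != 0 ->
  cong K (T * Pm) Pp -> cong K (H * Pp) Ap -> cong K (H' * Pm) Am ->
  cong K (R * Am) Ap -> cong K (T * H) (R * H').
Proof.
move=> Pm0 Pp0 Am0 hT hH hH' hR; apply: (@cong_cancel _ (Pm * Pp * Am)).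
  by rewrite -horner_coef0 !hornerM !horner_coef0 !mulf_neq0.
have -> : Pm * Pp * Am * (T * H) = (T * Pm) * (H * Pp) * Am by ring.
have -> : Pm * Pp * Am * (R * H') = Pp * (R * Am) * (H' * Pm) by ring.
apply: cong_trans (congM (congM hT hH) (cong_refl _)) _.
by apply: congM (cong_sym hH'); apply: congM => //; apply: cong_sym.
Qed.
End Truncation.

(** * The Perelomov-Popov formula *)

Section DiagonalEigenvalues.
Variables (N K : nat) (mu : 'I_N -> CC).

Let e l : {poly CC} := \poly_(k < K) diag_eigen mu k l.
(** These tails interpolate between [T N], which is 1, and [T 0], the truncated Casimir series. *)
Let T j : {poly CC} := 1 - 'X * \sum_(l < N | (j <= l)%N) e l.

Lemma diag_eigen_series l : cong K ((1 - mu l *: 'X) * e l) (T l.+1).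
Proof.
move=> k kK; rewrite mulrBl mul1r -scalerAl !coefB coefZ !coefXM coef_poly kK coef1.
case: k kK => [|k] kK /=; first by rewrite mulr0.
rewrite coef_poly coef_sum ltnW // addrAC subrr !sub0r; congr (- _).
by apply: eq_bigr => l' _; rewrite coef_poly ltnW.
Qed.

(** From [T j = T j.+1 - 'X * e j] and [diag_eigen_series], passing from [T j.+1] to [T j]
    multiplies by (1 - (mu_j + 1) u) / (1 - mu_j u). The induction starts at [T N] and adds one
    factor at a time, downwards in j. *)
Lemma casimir_series :
  cong K ((1 - 'X * \sum_l e l) * \prod_l (1 - mu l *: 'X))
         (\prod_l (1 - (mu l + 1) *: 'X)).
Proof.
have H d : (d <= N)%N ->
    cong K (T (N - d) * \prod_(l < N | (N - d <= l)%N) (1 - mu l *: 'X))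
           (\prod_(l < N | (N - d <= l)%N) (1 - (mu l + 1) *: 'X)).
  elim: d => [|d IH] dN.
    rewrite /T subn0 !big_pred0 ?mulr0 ?subr0 ?mulr1 //;
      by move=> l; apply/negbTE; rewrite -ltnNge.
  have jN : (N - d.+1 < N)%N by lia.
  pose l0 := Ordinal jN.
  have split (l : 'I_N) : ((N - d.+1 <= l) && (l != l0) = (N - d <= l))%N.
    by rewrite -val_eqE /=; lia.
  have {}IH := IH (ltnW dN).
  rewrite /T !(bigD1 (P := fun l : 'I_N => (N - d.+1 <= l)%N) l0) ?leqnn //=.
  rewrite !(eq_bigl _ _ split).
  set Tj := T (N - d) in IH; set p := \prod_(l < N | _) (1 - mu l *: 'X) in IH *.
  have -> : 1 - 'X * (e l0 + \sum_(l < N | (N - d <= l)%N) e l) = Tj - 'X * e l0.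
    by rewrite /Tj /T mulrDr opprD addrCA addrC.
  have -> : (Tj - 'X * e l0) * ((1 - mu l0 *: 'X) * p) =
      ((1 - mu l0 *: 'X) * Tj - 'X * ((1 - mu l0 *: 'X) * e l0)) * p by ring.
  apply: cong_trans _ (congM (cong_refl _) IH).
  rewrite [X in cong _ _ X]mulrA; apply: congM => //.
  have -> : (1 - (mu l0 + 1) *: 'X) * Tj = (1 - mu l0 *: 'X) * Tj - 'X * Tj.
    by rewrite scalerDl scale1r; ring.
  apply: congB => //; apply: congM => //; apply: cong_trans (diag_eigen_series l0) _.
  by rewrite /= /Tj (_ : (N - d.+1).+1 = N - d)%N //; lia.
by have := H N (leqnn N); rewrite /T subnn.
Qed.
End DiagonalEigenvalues.

(** * The Schur substitution evaluated at a point *)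

Section SchurSpecialization.
Variables (n N : nat) (v : 'I_n.+2 -> CC).
Hypothesis v0 : v ord0 = N%:R.
Local Notation K := n.+2.
Implicit Types (f g : ser n) (c : {mpoly CC[n.+2]}).

Definition spec f : {poly CC} := \poly_(k < K) (f k).@[v].

Lemma coef_spec f k : (k < K)%N -> (spec f)`_k = (f k).@[v].
Proof. by move=> kK; rewrite coef_poly kK. Qed.

Lemma spec_cong f g : (forall k, (k <= n.+1)%N -> f k = g k) -> cong K (spec f) (spec g).
Proof. by move=> e k kK; rewrite !coef_spec // e. Qed.

Lemma spec_mul f g : cong K (spec (smul f g)) (spec f * spec g).
Proof.
move=> k kK; rewrite coef_spec // coefM rmorph_sum; apply: eq_bigr => i _ /=.
by rewrite rmorphM !coef_spec // (leq_ltn_trans _ kK) ?leq_subr // -ltnS.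
Qed.

Lemma spec_one : cong K (spec (@sone n)) 1.
Proof. by move=> k kK; rewrite coef_spec // coef1 rmorph_nat. Qed.

Lemma spec_pow f j : cong K (spec (spow f j)) (spec f ^+ j).
Proof.
elim: j => [|j IH]; first exact: spec_one.
by rewrite exprS; apply: cong_trans (spec_mul _ _) _; apply: congM.
Qed.

Lemma spec_U : cong K (spec (@sU n)) 'X.
Proof. by move=> k kK; rewrite coef_spec // coefX rmorph_nat. Qed.

Lemma spec_const c : cong K (spec (sconst c)) c.@[v]%:P.
Proof.
move=> k kK; rewrite coef_spec // coefC /sconst.
by case: k kK => [|k] kK //=; rewrite meval0.
Qed.

Lemma spec_sub f g : cong K (spec (ssub f g)) (spec f - spec g).
Proof. by move=> k kK; rewrite coefB !coef_spec // rmorphB. Qed.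

Definition linfac c : {poly CC} := 1 - c.@[v] *: 'X.

Lemma spec_geom c : cong K (linfac c * spec (sgeom c)) 1.
Proof.
have -> : spec (sgeom c) = \poly_(k < K) c.@[v] ^+ k.
  by apply/polyP => k; rewrite !coef_poly rmorphXn.
exact: geom_inverse.
Qed.

Lemma linfac0 c : (linfac c)`_0 = 1.
Proof. by rewrite coefB coef1 coefZ coefX mulr0 subr0. Qed.

Definition Sspec : {poly CC} := \poly_(i < K) (if i == 0%N then 1 else v (inord i)).

(** Substitute t = u / (1 - c u) in the hypothesis and multiply by (1 - c u)^N: each factor 1 - x_l
    t becomes 1 - c u - x_l u. *)
Lemma spec_frac c (x : 'I_N -> CC) :
  cong K (Sspec * \prod_l (1 - x l *: 'X)) 1 ->
  cong K (spec (sfrac c) * \prod_l (linfac c - x l *: 'X)) (linfac c ^+ N).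
Proof.
move=> hS; set t := spec (smul (@sU n) (sgeom c)).
have t0 : t`_0 = 0.
  by rewrite coef_spec // /smul big_ord_recl big_ord0 /sU /= mul0r addr0 meval0.
have At : cong K (linfac c * t) 'X.
  apply: cong_trans (congM (cong_refl _) (spec_mul _ _)) _.
  rewrite mulrCA -[X in cong _ _ X]mulr1; apply: congM (spec_U) (spec_geom c).
have fracE : cong K (spec (sfrac c)) (Sspec \Po t).
  move=> k kK; rewrite coef_spec // /sfrac rmorphD rmorph_sum /= rmorph_nat.
  rewrite /Sspec poly_def rmorph_sum coef_sum /=.
  under [RHS]eq_bigr => i _ do rewrite linearZ /= comp_Xn_poly coefZ.
  rewrite (@sum_ord_trim _ k.+1 K
    (fun i => (if i == 0%N then 1 else v (inord i)) * (t ^+ i)`_k)) //.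
    rewrite big_ord_recl /= expr0 mul1r coef1 big_add1 big_mkord; congr (_ + _).
    apply: eq_bigr => i _; rewrite rmorphM /= /bump leq0n add1n /=.
    rewrite -[X in _ * X = _]coef_spec // (spec_pow _ i.+1) // /Sv /=.
    by rewrite (leq_trans (ltn_ord i)) ?mevalXU.
  by move=> j kj; rewrite coef_exp_small ?mulr0.
apply: cong_trans (congM fracE (cong_refl _)) _.
have := cong_comp t0 hS; rewrite rmorphM rmorph_prod rmorph1 /= => hS'.
have -> : linfac c ^+ N = linfac c ^+ N * 1 by rewrite mulr1.
apply: cong_trans _ (congM (cong_refl _) hS').
rewrite mulrCA; apply: congM => //.
rewrite -[X in _ ^+ X]card_ord -prodr_const -big_split /=; apply: cong_prod => l.
rewrite rmorphB rmorph1 /= comp_polyZ comp_polyX mulrBr mulr1 -scalerAr.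
by apply: congB => // k kK; rewrite !coefZ At.
Qed.

Lemma meval_binN j : (@binN n j).@[v] = 'C(N, j)%:R.
Proof.
rewrite /binN mevalM mevalC rmorph_prod /=.
have -> : \prod_(i < j) (@Nv n - i%:R).@[v] = (N ^_ j)%:R.
  elim: j => [|j IH]; first by rewrite big_ord0.
  rewrite big_ord_recr /= IH ffactnSr rmorphB /= mevalXU v0 rmorph_nat.
  have [jN|Nj] := leqP j N; first by rewrite natrM natrB.
  by rewrite ffact_small // mul0n mul0r.
by rewrite -bin_ffact natrM mulrC mulfK // pnatr_eq0 -lt0n fact_gt0.
Qed.

(** At [v] the formal exponent is the natural number [N], so the binomial series becomes the finite
    expansion of [(1 + g) ^+ N]. *)
Lemma spec_ratio : cong K (spec (@ratioN n) * linfac (@cminus n) ^+ N) (linfac (@cplus n) ^+ N).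
Proof.
set g := spec (ssub (smul (ssub (@sone n) (smul (sconst (@cplus n)) (@sU n)))
  (sgeom (@cminus n))) (@sone n)).
have gE : cong K (1 + g) (linfac (@cplus n) * spec (sgeom (@cminus n))).
  have -> : linfac (@cplus n) * spec (sgeom (@cminus n)) =
            1 + (linfac (@cplus n) * spec (sgeom (@cminus n)) - 1) by rewrite addrCA subrr addr0.
  apply: congD => //; apply: cong_trans (spec_sub _ _) _; apply: congB spec_one.
  apply: cong_trans (spec_mul _ _) _; apply: congM => //.
  apply: cong_trans (spec_sub _ _) _; apply: congB spec_one _.
  apply: cong_trans (spec_mul _ _) _; rewrite -mul_polyC.
  by apply: congM; [apply: spec_const|apply: spec_U].
have g0 : g`_0 = 0.
  have := gE 0%N isT; rewrite coefD coef1 coefM big_ord_recl big_ord0 addr0 linfac0 mul1r.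
  by rewrite subn0 (coef_spec (sgeom _)) // /sgeom expr0 meval1 /= => /eqP;
    rewrite -subr_eq0 addrAC subrr add0r => /eqP.
have ratioE : cong K (spec (@ratioN n)) ((1 + g) ^+ N).
  move=> k kK; rewrite coef_spec // /ratioN /spowN rmorph_sum exprDn coef_sum.
  pose F j : CC := 'C(N, j)%:R * (g ^+ j)`_k.
  rewrite [RHS](eq_bigr (fun j : 'I_N.+1 => F j)); last first.
    by move=> j _; rewrite /F expr1n mul1r coefMn mulr_natl.
  rewrite [LHS](eq_bigr (fun j : 'I_k.+1 => F j)); last first.
    by move=> j _; rewrite rmorphM /= meval_binN -[X in _ * X = _]coef_spec // spec_pow.
  (* Both sums are extended to a common range: terms with j > k vanish because g has no constant
     term, terms with j > N because the binomial coefficient does. *)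
  rewrite -(@sum_ord_trim _ k.+1 (k.+1 + N.+1) F) ?leq_addr //; last first.
    by move=> j kj; rewrite /F coef_exp_small ?mulr0.
  rewrite (@sum_ord_trim _ N.+1 _ F) ?leq_addl // => j Nj.
  by rewrite /F bin_small // mul0r.
apply: cong_trans (congM (cong_trans ratioE (congX _ gE)) (cong_refl _)) _.
rewrite -exprMn; apply: congX; rewrite -mulrA -[X in cong _ _ X]mulr1.
by apply: congM => //; rewrite mulrC; apply: spec_geom.
Qed.

(** The shift by (N - 1)/2 is such that [cminus] and [cplus] turn the factors of [hS] into 1 - mu_l
    u and 1 - (mu_l + 1) u, the denominators and numerators of the Casimir series. That series then
    satisfies the identity defining [phi], and cancelling [H] identifies the coefficients. *)
Lemma schur_specialization (phi : nat -> {mpoly CC[n.+2]}) (mu : 'I_N -> CC) :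
  schur_values phi ->
  cong K (Sspec * \prod_l (1 - (mu l - (N%:R - 1) / 2%:R) *: 'X)) 1 ->
  forall k, (0 < k <= n)%N -> (phi k).@[v] = \sum_l diag_eigen mu k l.
Proof.
move=> hphi hS k /andP [k0 kn].
pose x l : CC := mu l - (N%:R - 1) / 2%:R.
pose T : {poly CC} := 1 - 'X * \sum_l \poly_(k < K) diag_eigen mu k l.
have two : (2%:R : CC) != 0 by rewrite pnatr_eq0.
have halfE : (@Defs.half n).@[v] = 2%:R^-1 by rewrite mevalC.
have minusE l : linfac (@cminus n) - x l *: 'X = 1 - mu l *: 'X.
  rewrite /linfac /cminus rmorphM /= halfE rmorphB /= meval1 mevalXU v0 /x.
  by rewrite -addrA -opprD -scalerDl; congr (1 - _ *: _); field.
have plusE l : linfac (@cplus n) - x l *: 'X = 1 - (mu l + 1) *: 'X.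
  rewrite /linfac /cplus rmorphM /= halfE rmorphD /= meval1 mevalXU v0 /x.
  by rewrite -addrA -opprD -scalerDl; congr (1 - _ *: _); field.
have hm := spec_frac (@cminus n) hS; have hp := spec_frac (@cplus n) hS.
rewrite -/x (eq_bigr _ (fun l _ => minusE l)) in hm.
rewrite -/x (eq_bigr _ (fun l _ => plusE l)) in hp.
have hT := casimir_series (K := K) mu; rewrite -/T in hT.
have unit0 (f : 'I_N -> CC) : (\prod_l (1 - f l *: 'X))`_0 = 1.
  rewrite -horner_coef0 horner_prod big1 // => l _.
  by rewrite !hornerE ?mulr0 ?subr0.
set Pm := \prod_l _ in hm hT; set Pp := \prod_l _ in hp hT.
set H := spec (sfrac (@cplus n)) in hp; set H' := spec (sfrac (@cminus n)) in hm.
have TE : cong K (T * H) (spec (@ratioN n) * H').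
  apply: (cong_cross _ _ _ hT hp hm spec_ratio); rewrite ?unit0 ?oner_neq0 //.
  by rewrite -horner_coef0 horner_exp horner_coef0 linfac0 expr1n oner_neq0.
have LE : cong K (H * spec (slhs phi)) (H * T).
  rewrite [H * T]mulrC; apply: cong_trans _ (cong_sym TE).
  rewrite mulrC; apply: cong_trans (cong_sym (spec_mul _ _)) _.
  by apply: cong_trans _ (spec_mul _ _); apply: spec_cong.
have H0 : H`_0 != 0.
  rewrite coef_spec // /sfrac big_geq // addr0 meval1; exact: oner_neq0.
(* [phi k] sits at order k + 1 of the series, so k <= n is exactly the range seen modulo [X^K]. *)
have kK : (k.+1 < K)%N by rewrite !ltnS.
have := cong_cancel H0 LE kK; rewrite coef_spec // /slhs /=.
rewrite eqSS (gtn_eqF k0) coefB coef1 coefXM /= sub0r mevalN => /oppr_inj ->.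
by rewrite coef_sum; apply: eq_bigr => l _; rewrite coef_poly ltnW.
Qed.
End SchurSpecialization.

(** * Polynomials in the entries of a generic matrix as a gl(N)-module *)

Section PolynomialModule.
Variable N : nat.
Local Notation A := {mpoly CC[#|{: 'I_N * 'I_N}|]}.
Implicit Types (i j k l : 'I_N) (p q : A).

Let idx i k : 'I_#|{: 'I_N * 'I_N}| := enum_rank (i, k).
Definition xvar i k : A := 'X_(idx i k).
(** The Capelli polarization operator: a derivation that infinitesimally replaces row j by row i. *)
Definition polarize i j p : A := \sum_k xvar i k * p^`M(idx j k).

Lemma polarize_linear i j : linear (polarize i j).
Proof.
move=> c p q; rewrite scaler_sumr -big_split; apply: eq_bigr => k _ /=.
by rewrite mderivD mderivZ mulrDr scalerAr.
Qed.

HB.instance Definition _ i j :=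
  GRing.isLinear.Build CC A A *:%R (polarize i j) (polarize_linear i j).

Definition glE i j : {linear A -> A} := polarize i j.

Lemma polarizeM i j p q : polarize i j (p * q) = polarize i j p * q + p * polarize i j q.
Proof.
rewrite /polarize mulr_suml mulr_sumr -big_split; apply: eq_bigr => k _ /=.
by rewrite mderivM; ring.
Qed.

Lemma polarize1 i j : polarize i j 1 = 0.
Proof. by rewrite /polarize big1 // => k _; rewrite -mpolyC1 mderivC mulr0. Qed.

Lemma polarize_xvar i j k l : polarize i j (xvar k l) = (j == k)%:R * xvar i l.
Proof.
have dX a b : (xvar k l)^`M(idx a b) = ((a == k) && (b == l))%:R.
  rewrite /xvar mderivX mnm1E (inj_eq enum_rank_inj) xpair_eqE.
  rewrite [k == a]eq_sym [l == b]eq_sym.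
  case: andP => [[/eqP -> /eqP ->]|_]; last by rewrite scale0r.
  rewrite scale1r (_ : (U_(idx k l) - U_(idx k l))%MM = 0%MM) ?mpolyX0 //.
  by apply/mnmP => m; rewrite mnmBE mnm0E subnn.
rewrite /polarize (bigD1 l) //= dX eqxx andbT mulrC big1 ?addr0 // => m /negPf ml.
by rewrite dX ml andbF mulr0.
Qed.

(** A composite of two operators is a first-order term plus a second-order part symmetric in (i, j)
    and (k, l); the latter cancels in the commutator. *)
Lemma polarize_relations : gl_relations glE.
Proof.
have E i j k l p : polarize i j (polarize k l p) = (j == k)%:R *: polarize i l p +
    \sum_a \sum_b xvar k b * (xvar i a * p^`M(idx l b)^`M(idx j a)).
  have -> : polarize i j (polarize k l p) =
      \sum_b polarize i j (xvar k b * p^`M(idx l b)) by exact: (linear_sum (glE i j)).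
  rewrite [polarize i l p]/polarize scaler_sumr [X in _ = _ + X]exchange_big -big_split /=.
  apply: eq_bigr => b _; rewrite polarizeM polarize_xvar -mulrA mulr_natl scaler_nat.
  by congr (_ + _); rewrite /polarize mulr_sumr.
move=> i j k l p; rewrite /= !E [X in _ + X - _]exchange_big /= [l == i]eq_sym.
rewrite opprD addrACA [X in _ + X = _](_ : _ = 0) ?addr0 //.
apply/eqP; rewrite subr_eq0; apply/eqP.
apply: eq_bigr => a _; apply: eq_bigr => b _.
by rewrite mulrCA mderiv_comm.
Qed.

Lemma polarize_prod i j (I : eqType) (s : seq I) (F : I -> A) : uniq s ->
  polarize i j (\prod_(a <- s) F a) =
  \sum_(a <- s) polarize i j (F a) * \prod_(b <- s | b != a) F b.
Proof.
elim: s => [|a s IH] /=; first by rewrite !big_nil polarize1.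
case/andP=> nas us; rewrite !big_cons polarizeM IH // eqxx; congr (_ * _ + _).
  rewrite big_seq [RHS]big_seq_cond; apply: eq_bigl => b.
  by case: (boolP (b \in s)) => //= bs; apply/esym; apply: contra nas => /eqP <-.
rewrite mulr_sumr; apply: eq_big_seq => b bs.
rewrite big_cons ifT; last by apply: contra nas => /eqP ->.
by rewrite mulrCA.
Qed.

Lemma polarize_det i j r (M : 'M[A]_r) :
  polarize i j (\det M) =
  \sum_a \det (\matrix_(b, c) if b == a then polarize i j (M b c) else M b c).
Proof.
rewrite /determinant [LHS](linear_sum (glE i j)) [RHS]exchange_big; apply: eq_bigr => s _ /=.
rewrite -mulr_sumr; set sg := (-1) ^+ _.
have -> : polarize i j (sg * \prod_a M a (s a)) = sg * polarize i j (\prod_a M a (s a)).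
  by rewrite /sg -signr_odd !mulr_sign; case: odd; rewrite ?linearN.
congr (_ * _); rewrite polarize_prod ?index_enum_uniq //; apply: eq_bigr => a _.
rewrite [RHS](bigD1 a) //= mxE eqxx; congr (_ * _).
by apply: eq_bigr => b /negPf ba; rewrite mxE ba.
Qed.

Lemma det_row0 r (M : 'M[A]_r) a : (forall b, M a b = 0) -> \det M = 0.
Proof. by move=> M0; rewrite (expand_det_row M a) big1 // => b _; rewrite M0 mul0r. Qed.

Definition minor (r : 'I_N) : A :=
  \det (\matrix_(a < r.+1, b < r.+1) xvar (widen_ord (ltn_ord r) a) (widen_ord (ltn_ord r) b)).

(** Replacing row j by row i gives zero if j > r, a repeated row if i < j <= r, and the same minor
    if i = j <= r. *)
Lemma minor_highest (r : 'I_N) : highest_weight glE (fun i => (i <= r)%N%:R) (minor r).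
Proof.
set w := widen_ord (ltn_ord r).
have E i j : polarize i j (minor r) =
    \sum_a \det (\matrix_(b < r.+1, c < r.+1)
      if b == a then (j == w b)%:R * xvar i (w c) else xvar (w b) (w c)).
  rewrite polarize_det; apply: eq_bigr => a _; congr (\det _); apply/matrixP => b c.
  by rewrite !mxE polarize_xvar.
have E0 i j a : j != w a -> \det (\matrix_(b < r.+1, c < r.+1)
      if b == a then (j == w b)%:R * xvar i (w c) else xvar (w b) (w c)) = 0.
  by move=> /negPf ja; apply: (@det_row0 _ _ a) => b; rewrite mxE eqxx ja mul0r.
split=> [i j ij|i] /=; rewrite E.
  apply: big1 => a _; have [ja|] := eqVneq j (w a); last exact: E0.
  have ir : (i < r.+1)%N by apply: (ltn_trans ij); rewrite ja /= ltn_ord.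
  have na : Ordinal ir != a by rewrite -val_eqE /= ltn_eqF // (leq_trans ij) // ja.
  apply: (determinant_alternate na) => c; rewrite !mxE (negPf na) eqxx -ja eqxx mul1r.
  by congr xvar; apply: val_inj.
have [ir|ri] := leqP i r; last first.
  rewrite scale0r big1 // => a _; apply: E0; apply: contraTneq ri => ->.
  by rewrite -leqNgt /= -ltnS ltn_ord.
have iE : i = w (Ordinal (ir : (i < r.+1)%N)) by apply: val_inj.
rewrite scale1r (bigD1 (Ordinal (ir : (i < r.+1)%N))) //= big1 ?addr0 => [|a na].
  congr (\det _); apply/matrixP => b c; rewrite !mxE.
  by case: eqP => [->|//]; rewrite -iE eqxx mul1r; congr xvar; apply: val_inj.
by apply: E0; rewrite {1}iE; apply: contra na => /eqP [e]; apply/eqP; apply: val_inj.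
Qed.

Lemma highest_weightM lam mu p q : highest_weight glE lam p -> highest_weight glE mu q ->
  highest_weight glE (fun i => lam i + mu i) (p * q).
Proof.
case=> up dp [uq dq]; split=> [i j ij|i] /=; rewrite polarizeM.
  by rewrite [polarize i j p]up // [polarize i j q]uq // mul0r mulr0 addr0.
by rewrite [polarize i i p]dp [polarize i i q]dq -scalerAl -scalerAr scalerDl.
Qed.

Lemma highest_weight_eq lam mu p :
  lam =1 mu -> highest_weight glE lam p -> highest_weight glE mu p.
Proof. by move=> e [up dp]; split=> // i; rewrite dp e. Qed.

Lemma highest_weight1 : highest_weight glE (fun=> 0) 1.
Proof. by split=> [i j _|i] /=; rewrite polarize1 ?scale0r. Qed.

Lemma highest_weightX lam p d : highest_weight glE lam p ->
  highest_weight glE (fun i => lam i *+ d) (p ^+ d).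
Proof.
move=> hp; elim: d => [|d IH]; first exact: highest_weight1.
rewrite exprS; apply: highest_weight_eq (highest_weightM hp IH) => i.
by rewrite mulrS.
Qed.

Lemma minor_neq0 r : minor r != 0.
Proof.
(* Evaluation at the identity matrix. *)
apply/eqP => /(congr1 (meval (fun m => ((enum_val m).1 == (enum_val m).2)%:R))).
rewrite meval0 /minor -det_map_mx (_ : map_mx _ _ = 1%:M) ?det1; last first.
  by apply/matrixP => a b; rewrite !mxE /= /xvar mevalXU enum_rankK /= -val_eqE.
by apply/eqP; rewrite oner_neq0.
Qed.

(** Since gl(N) acts by derivations, weights add under products; the exponent [a r] of the r-th
    minor is a difference of consecutive parts of the partition. *)
Lemma partition_highest (a : 'I_N -> nat) :
  exists2 v : A, v != 0 &
    highest_weight glE (fun i => \sum_(r < N | (i <= r)%N) (a r)%:R) v.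
Proof.
exists (\prod_r minor r ^+ a r).
  by apply/prodf_neq0 => r _; rewrite expf_neq0 ?minor_neq0.
pose lam (s : seq 'I_N) (i : 'I_N) : CC := \sum_(r <- s) (i <= r)%N%:R *+ a r.
apply: (@highest_weight_eq (lam (index_enum _))).
  move=> i; rewrite /lam [RHS]big_mkcond; apply: eq_bigr => r _.
  by case: leqP => //= _; rewrite mul0rn.
elim: (index_enum _) => [|r s IH].
  by rewrite big_nil; apply: highest_weight_eq highest_weight1 => i; rewrite /lam big_nil.
rewrite big_cons.
apply: highest_weight_eq (highest_weightM (highest_weightX (a r) (minor_highest r)) IH) => i.
by rewrite /lam big_cons.
Qed.
End PolynomialModule.

(** * Polynomials vanishing at all large natural points *)

Section Vanishing.
Variable F : numFieldType.

Lemma poly_nat_vanish (B : nat) (q : {poly F}) :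
  (forall t, (B <= t)%N -> q.[t%:R] = 0) -> q = 0.
Proof.
move=> q0; apply/eqP/negPn/negP => nq0.
have := @max_poly_roots F q [seq (B + i)%:R | i <- iota 0 (size q)] nq0.
rewrite size_map size_iota ltnn => H; suff : false by []; apply: H.
  by apply/allP => _ /mapP [i _ ->]; rewrite rootE q0 ?leq_addr.
rewrite map_inj_uniq ?iota_uniq // => i j /eqP.
by rewrite eqr_nat eqn_add2l => /eqP.
Qed.

Lemma muni_meval k (p : {mpoly F[k.+1]}) (w : nat -> F) :
  p.@[fun i => w i] = (map_poly (meval (fun i : 'I_k => w i)) (muni p)).[w k].
Proof.
rewrite mevalE muniE rmorph_sum horner_sum; apply: eq_bigr => m _ /=.
rewrite map_polyZ map_polyXn hornerZ hornerXn /= mevalZ mevalX big_ord_recr /= mulrA.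
by congr (_ * _ * _); apply: eq_bigr => i _; rewrite mnmE.
Qed.

(** The coefficient at [m] is recovered from the coefficient of degree [m ord_max] in the last
    variable, at the restriction of [m] to the other variables. *)
Lemma muni_inj0 k (p : {mpoly F[k.+1]}) : muni p = 0 -> p = 0.
Proof.
move=> p0; apply/mpolyP => m; rewrite mcoeff0.
have := congr1 (fun q : {poly {mpoly F[k]}} =>
  (q`_(m ord_max))@_[multinom m (widen_ord (leqnSn k) i) | i < k]) p0.
rewrite coef0 mcoeff0 muniE coef_sum raddf_sum /= => E; rewrite -[RHS]E {E}.
rewrite (eq_bigr (fun m' => if m' == m then p@_m else 0)) => [|m' _].
  rewrite -big_mkcond /=; case: (boolP (m \in msupp p)) => mp.
    by rewrite -big_filter filter_pred1_uniq ?msupp_uniq // big_seq1.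
  by rewrite memN_msupp_eq0 // big1.
rewrite coefZ coefXn; case: (altP (m' =P m)) => [->|nm].
  by rewrite eqxx mulr1 mcoeffZ mcoeffX eqxx mulr1.
case: eqP => [e|_]; last by rewrite mulr0 mcoeff0.
rewrite mulr1 mcoeffZ mcoeffX; case: eqP => [/mnmP e'|_]; last by rewrite mulr0.
case/eqP: nm; apply/mnmP => i; have [ik|] := ltnP i k.
  have := e' (Ordinal ik); rewrite !mnmE.
  by rewrite (_ : widen_ord _ _ = i) //; apply: val_inj.
move=> ki; have -> : i = ord_max by apply/val_inj/eqP; rewrite eqn_leq ki -ltnS ltn_ord.
by rewrite e.
Qed.

(** With the other variables fixed at natural numbers, the polynomial in the last variable has
    infinitely many roots; its coefficients then fall under the induction hypothesis. *)
Lemma mpoly_nat_vanish (B k : nat) (p : {mpoly F[k]}) :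
  (forall a : nat -> nat, (forall i, (B <= a i)%N) -> p.@[fun i => (a i)%:R] = 0) -> p = 0.
Proof.
elim: k p => [|k IH] p p0.
  apply/mpolyP => m; rewrite mcoeff0; case: (boolP (m \in msupp p)); last first.
    by move/memN_msupp_eq0.
  move=> mp; have := p0 (fun=> B) (fun=> leqnn B).
  rewrite mevalE (bigD1_seq m) ?msupp_uniq //= big_ord0 mulr1 big1 ?addr0 // => m' /eqP [].
  by apply/mnmP => [[]].
apply: muni_inj0; apply/polyP => d; rewrite coef0; apply: IH => a aB.
rewrite -[LHS](coef_map (meval (fun i : 'I_k => (a i)%:R))).
rewrite (@poly_nat_vanish B (map_poly _ _)) ?coef0 // => t tB.
have := p0 (fun i => if i == k then t else a i) _.
rewrite (muni_meval p (fun i => (if i == k then t else a i)%:R)) eqxx => <-.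
  congr (_.[_]); apply: eq_map_poly => q; apply: meval_eq => i.
  by rewrite (ltn_eqF (ltn_ord i)).
by move=> i; case: eqP.
Qed.
End Vanishing.

(** * Complete symmetric functions and factorization of truncated series *)

(** The ring is general because the arguments are complex numbers in one use and polynomials in
    another. *)
Fixpoint complete_sym (R : comNzRingType) (s : seq R) (k : nat) : R :=
  if s is x :: s' then \sum_(i < k.+1) x ^+ i * complete_sym s' (k - i)
  else (k == 0%N)%:R.

Lemma complete_sym0 (R : comNzRingType) (s : seq R) : complete_sym s 0 = 1.
Proof. by elim: s => //= x s IH; rewrite big_ord_recl big_ord0 addr0 mul1r. Qed.

Lemma rmorph_complete_sym (R S : comNzRingType) (f : {rmorphism R -> S}) s k :
  f (complete_sym s k) = complete_sym (map f s) k.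
Proof.
elim: s k => [|x s IH] k /=; first exact: rmorph_nat.
by rewrite rmorph_sum; apply: eq_bigr => i _; rewrite rmorphM rmorphXn IH.
Qed.

Lemma complete_sym_series (F : fieldType) K (s : seq F) :
  cong K (\poly_(k < K) complete_sym s k * \prod_(x <- s) (1 - x *: 'X)) 1.
Proof.
elim: s => [|x s IH].
  by rewrite big_nil mulr1 => k kK; rewrite coef_poly kK coef1.
rewrite big_cons; set h := (X in X * (_ * _)).
have hE : cong K h (\poly_(k < K) x ^+ k * \poly_(k < K) complete_sym s k).
  move=> k kK; rewrite coefM coef_poly kK /=; apply: eq_bigr => i _.
  by rewrite !coef_poly !ifT //; have := ltn_ord i; lia.
apply: cong_trans (congM hE (cong_refl _)) _.
rewrite mulrACA [_ * (1 - _)]mulrC -[X in cong _ _ X]mulr1.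
by apply: congM IH; apply: geom_inverse.
Qed.

(** A Bezout relation between [p] and ['X^K], with the cofactor of [p] truncated. *)
Lemma series_inverse (F : fieldType) K (p : {poly F}) : p`_0 = 1 ->
  exists2 q : {poly F}, (size q <= K)%N & cong K (p * q) 1.
Proof.
move=> p0; have : coprimep p ('X^K).
  by rewrite coprimep_expr // coprimepX rootE horner_coef0 p0 oner_neq0.
case/Bezout_eq1_coprimepP => [[u w] /= e].
exists (take_poly K u); first exact: size_take_poly.
have tu : cong K (take_poly K u) u by move=> k kK; rewrite coef_take_poly kK.
apply: cong_trans (congM (cong_refl p) tu) _ => k kK.
by rewrite -e coefD coefMXn kK addr0 mulrC.
Qed.

Lemma linear_factors (F : closedFieldType) (p : {poly F}) : p`_0 = 1 ->
  exists2 s : seq F, (size s < size p)%N & p = \prod_(x <- s) (1 - x *: 'X).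
Proof.
move=> p0; have pn0 : p != 0 by apply: contra_eq_neq p0 => ->; rewrite coef0 eq_sym oner_neq0.
have [r pE] := closed_field_poly_normal p.
have r0 : 0 \notin r.
  rewrite -root_prod_XsubC -(@rootZ _ _ (lead_coef p)) ?lead_coef_eq0 // -pE.
  by rewrite rootE horner_coef0 p0 oner_neq0.
exists [seq z^-1 | z <- r].
  by rewrite size_map pE size_scale ?lead_coef_eq0 // size_prod_XsubC.
have qE : \prod_(z <- r) ('X - z%:P) =
    (\prod_(z <- r) - z) *: \prod_(x <- [seq z^-1 | z <- r]) (1 - x *: 'X).
  rewrite big_map; elim: (r) r0 => [|z s IH]; first by rewrite !big_nil scale1r.
  rewrite inE negb_or eq_sym => /andP [z0 s0]; rewrite !big_cons IH //.
  have -> : 'X - z%:P = (- z) *: (1 - z^-1 *: 'X).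
    by rewrite scalerBr scalerA mulNr mulfV // scaleN1r opprK addrC scaleNr alg_polyC.
  by rewrite -scalerAl -scalerAr scalerA.
set q := \prod_(x <- map _ _) _ in qE *; move: pE; rewrite qE scalerA; set c := _ * _ => pE.
have q0 : q`_0 = 1.
  by rewrite -horner_coef0 horner_prod big1 // => x _; rewrite !hornerE ?mulr0 ?subr0.
by move: p0; rewrite pE coefZ q0 mulr1 => ->; rewrite scale1r.
Qed.

(** The inverse modulo [X^K] has degree below K, hence at most K - 1 <= N linear factors; the
    default 0 of [nth] supplies trivial factors up to N. *)
Lemma series_factor (F : closedFieldType) K N (p : {poly F}) :
  (K <= N.+1)%N -> p`_0 = 1 ->
  exists x : 'I_N -> F, cong K (p * \prod_l (1 - x l *: 'X)) 1.
Proof.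
case: K => [|K] KN p0; first by exists (fun=> 0).
have [q sq qE] := series_inverse K.+1 p0.
have q0 : q`_0 = 1.
  have := qE 0%N isT; rewrite -!horner_coef0 hornerM !horner_coef0 p0 mul1r => ->.
  by rewrite coef1.
have [s ss sE] := linear_factors q0.
have sN : (size s <= N)%N by rewrite -ltnS (leq_trans ss) // (leq_trans sq).
exists (fun l => nth 0 s l); suff <- : q = \prod_(l < N) (1 - nth 0 s l *: 'X) by [].
rewrite sE (big_nth 0) -(big_mkord predT (fun l => 1 - nth 0 s l *: 'X)).
rewrite [RHS](big_cat_nat _ (n := size s)) //= [X in _ * X]big_nat_cond.
rewrite [X in _ * X]big1 ?mulr1 // => l /andP [/andP [sl _] _].
by rewrite nth_default // scale0r subr0.
Qed.

(** * The identity at the points given by highest weights *)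

Section SchurPoints.
Variables (n N : nat).
Local Notation K := n.+2.

Definition schur_point (s : nat -> CC) (i : 'I_n.+2) : CC :=
  if i == ord0 then N%:R else s i.

Lemma Sspec_schur_point s :
  Sspec (schur_point s) = \poly_(i < K) (if i == 0%N then 1 else s i).
Proof.
apply/polyP => k; rewrite !coef_poly; case: ltnP => // kK; case: eqP => // /eqP k0.
by rewrite /schur_point -val_eqE /= inordK // (negPf k0).
Qed.

Lemma meval_Phi (phi : nat -> {mpoly CC[n.+2]}) (P : {mpoly CC[n.+1]}) v c :
  v ord0 = N%:R -> (forall k, (0 < k <= n)%N -> (phi k).@[v] = c k) ->
  (Phi phi P).@[v] = P.@[fun j : 'I_n.+1 => if j == ord0 then N%:R else c (val j)].
Proof.
move=> v0 hc; rewrite /Phi comp_mpoly_meval; apply: meval_eq => j; rewrite tnth_mktuple.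
case: eqP => [_|/eqP j0]; first by rewrite mevalXU.
by rewrite hc // lt0n -ltnS ltn_ord andbT; move: j0; rewrite -val_eqE.
Qed.

Lemma meval_sign_subst (p : {mpoly CC[n.+2]}) s :
  (sign_subst p).@[schur_point s] = p.@[schur_point (fun i => (-1) ^+ i * s i)].
Proof.
rewrite /sign_subst comp_mpoly_meval; apply: meval_eq => i; rewrite tnth_mktuple.
rewrite mevalZ mevalXU /schur_point; case: eqP => [->|//]; exact: mul1r.
Qed.

Lemma schur_duality (m : nat) (alpha : 'S_m) (P Q : {mpoly CC[n.+1]})
    (phi : nat -> {mpoly CC[n.+2]}) (a : 'I_N -> nat) (s : nat -> CC) :
  (0 < N)%N ->
  is_universal_wgl alpha P -> is_universal_wgl (alpha^-1)%g Q -> schur_values phi ->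
  let lam (i : 'I_N) : CC := \sum_(r < N | (i <= r)%N) (a r)%:R in
  cong K (\poly_(i < K) (if i == 0%N then 1 else s i) *
          \prod_l (1 - (shifted lam l - (N%:R - 1) / 2%:R) *: 'X)) 1 ->
  (Phi phi Q).@[schur_point s] = ((-1) ^+ m *: sign_subst (Phi phi P)).@[schur_point s].
Proof.
move=> N0 hP hQ hphi lam hs.
have [v v0 hw] := partition_highest a.
have := universal_duality N0 (@polarize_relations N) hw v0 hP hQ.
rewrite mevalZ meval_sign_subst => E.
pose lam' i := - lam (rev_ord i).
have pt0 s' : schur_point s' ord0 = N%:R by [].
rewrite (meval_Phi Q (pt0 _) (schur_specialization (pt0 _) hphi (mu := shifted lam) _)); last first.
  by rewrite Sspec_schur_point.
rewrite E; congr (_ * _); apply/esym.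
apply: (meval_Phi P (pt0 _) (schur_specialization (pt0 _) hphi (mu := shifted lam') _)).
rewrite Sspec_schur_point.
(* Replacing u by -u in [hs] puts the signs (-1)^i on [s i] and negates the coordinates. *)
have := cong_comp (t := - 'X) _ hs; rewrite coefN coefX oppr0 => /(_ erefl).
rewrite rmorphM rmorph_prod rmorph1 /=; set p := (X in cong _ (X * _) _ -> _).
set q := (X in cong _ (_ * X) _ -> _); set p' := (X in _ -> cong _ (X * _) _).
set q' := (X in _ -> cong _ (_ * X) _).
have -> : p = p'.
  rewrite /p /p' !poly_def rmorph_sum; apply: eq_bigr => i _ /=.
  rewrite comp_polyZ comp_Xn_poly.
  have -> : (- 'X) ^+ i = ((-1) ^+ i : CC) *: 'X^i.
    by rewrite [LHS]exprNn -[RHS]mul_polyC polyC_exp polyCN polyC1.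
  rewrite scalerA; case: eqP => [->|_]; first by rewrite mulr1.
  by rewrite mulrC.
have -> // : q = q'.
(* The numbers N - 1 - l - (N - 1)/2 change sign under reversal of the indices, so the negated
   coordinates, reversed, are those of [lam']. *)
rewrite /q (reindex_inj rev_ord_inj); apply: eq_bigr => l _.
rewrite rmorphB rmorph1 /= comp_polyZ comp_polyX scalerN -scaleNr.
congr (1 - _ *: 'X); rewrite /shifted /lam' /=.
have -> : (N - (N - l.+1).+1 = l)%N by have := ltn_ord l; lia.
by rewrite natrB ?ltn_ord // -natr1; field.
Qed.
End SchurPoints.

(** * From highest weights to all points *)

(* The coordinates x_l = lam_l + (N+1)/2 - l (l counted from 1) of the weight with
   lam_l = b_l + b_(l+1) + ... *)
Definition weight_coord (R : nzRingType) (c : CC -> R) N (b : 'I_N -> R) (l : 'I_N) : R :=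
  \sum_(r < N | (l <= r)%N) b r + c ((N - l.+1)%:R - (N%:R - 1) / 2%:R).

Lemma weight_coord_surj N (x : 'I_N -> CC) : exists b, weight_coord id b =1 x.
Proof.
(* [y] continues by 0 at index N, so that the telescoping sum from l leaves [y l]. *)
pose y l : CC := if insub l is Some i then x i - ((N - l.+1)%:R - (N%:R - 1) / 2%:R) else 0.
exists (fun r : 'I_N => y r - y r.+1) => l; rewrite /weight_coord.
have -> : \sum_(r < N | (l <= r)%N) (y r - y r.+1) = y l.
  rewrite -(big_geq_mkord _ _ xpredT (fun r => y r - y r.+1)).
  rewrite -[LHS]opprK -sumrN (eq_bigr (fun r => y r.+1 - y r)) => [|r _]; last by rewrite opprB.
  rewrite telescope_sumr ?opprB; last exact/ltnW/ltn_ord.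
  by rewrite [y N]/y insubF ?ltnn ?subr0.
by rewrite /y valK subrK.
Qed.

Lemma schur_duality_dense (n N m : nat) (alpha : 'S_m) (P Q : {mpoly CC[n.+1]})
    (phi : nat -> {mpoly CC[n.+2]}) (s : nat -> CC) :
  (n < N)%N ->
  is_universal_wgl alpha P -> is_universal_wgl (alpha^-1)%g Q -> schur_values phi ->
  (Phi phi Q - (-1) ^+ m *: sign_subst (Phi phi P)).@[schur_point N s] = 0.
Proof.
move=> nN hP hQ hphi; set F := _ - _.
pose pt (R : comNzRingType) (c : CC -> R) (x : 'I_N -> R) (i : 'I_n.+2) : R :=
  if i == ord0 then c N%:R else complete_sym [seq x l | l <- enum 'I_N] i.
have hsym (x : 'I_N -> CC) :
    cong n.+2 (\poly_(k < n.+2) complete_sym [seq x l | l <- enum 'I_N] k *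
               \prod_l (1 - x l *: 'X)) 1.
  by have := complete_sym_series (K := n.+2) [seq x l | l <- enum 'I_N]; rewrite big_map big_enum.
(* [G] is [F] at the complete symmetric functions of the coordinates, as a polynomial in the [b_r].
   At natural [b] the coordinates come from a partition, which forces [G] to vanish identically. *)
pose G : {mpoly CC[N]} := F \mPo
  [tuple pt _ (@mpolyC N CC) (weight_coord (@mpolyC N CC) (fun r => 'X_r)) i | i < n.+2].
have GE b : G.@[b] = F.@[pt _ id (weight_coord id b)].
  rewrite comp_mpoly_meval; apply: meval_eq => i; rewrite tnth_mktuple /pt.
  case: eqP => _; first by rewrite mevalC.
  rewrite (rmorph_complete_sym (meval b)) -map_comp; congr complete_sym.
  apply: eq_map => l /=; rewrite /weight_coord rmorphD rmorph_sum /= mevalC.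
  by congr (_ + _); apply: eq_bigr => r _; rewrite mevalXU.
have G0 : G = 0.
  apply: (@mpoly_nat_vanish _ 0) => a _; rewrite GE.
  set x := weight_coord _ _; set h := complete_sym [seq x l | l <- enum 'I_N].
  rewrite (meval_eq (v2 := schur_point N h)) // mevalB; apply/eqP; rewrite subr_eq0.
  apply/eqP; apply: (schur_duality (a := fun r : 'I_N => a r) _ hP hQ hphi).
    exact: leq_ltn_trans nN.
  apply: cong_trans _ (hsym x); apply: congM.
    by move=> k kK; rewrite !coef_poly kK; case: eqP => // ->; rewrite /h complete_sym0.
  by apply: cong_prod => l; rewrite /x /weight_coord addrA.
(* Here N > n provides enough coordinates to realize arbitrary values [s]. *)
have [|x xE] := @series_factor CC n.+2 N (\poly_(i < n.+2) (if i == 0%N then 1 else s i)) nN.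
  by rewrite coef_poly.
have [b bE] := weight_coord_surj x.
have := GE b; rewrite G0 meval0 => E; rewrite [RHS]E; apply: meval_eq => i.
rewrite /schur_point /pt; case: eqP => // /eqP i0.
have xE' : cong n.+2 (\poly_(k < n.+2) complete_sym [seq weight_coord id b l | l <- enum 'I_N] k)
   (\poly_(i < n.+2) (if i == 0%N then 1 else s i)).
  apply: (@cong_cancel _ _ (\prod_l (1 - x l *: 'X))).
    by rewrite -horner_coef0 horner_prod prodf_seq_neq0; apply/allP => l _;
      rewrite !hornerE ?mulr0 ?subr0 oner_neq0.
  rewrite mulrC [X in cong _ _ X]mulrC; apply: cong_trans (cong_sym xE).
  by rewrite (eq_map bE); apply: hsym.
have := xE' i (ltn_ord i); rewrite !coef_poly ltn_ord ifN => [->//|].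
by move: i0; rewrite -val_eqE.
Qed.

Theorem theorem5 (m : nat) (alpha : 'S_m) (n : nat)
    (P Q : {mpoly CC[n.+1]}) (phi : nat -> {mpoly CC[n.+2]}) :
  is_universal_wgl alpha P ->
  is_universal_wgl (alpha^-1)%g Q ->
  schur_values phi ->
  Phi phi Q = (-1) ^+ m *: sign_subst (Phi phi P).
Proof.
move=> hP hQ hphi; apply/eqP; rewrite -subr_eq0; apply/eqP.
(* The bound n + 1 makes coordinate 0, the value of N, larger than n. *)
apply: (@mpoly_nat_vanish _ n.+1) => a aB.
rewrite -(schur_duality_dense (fun i => (a i)%:R) (aB 0%N) hP hQ hphi).
by apply: meval_eq => i; rewrite /schur_point; case: eqP => // ->.
Qed.
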